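(* Let $K_n=(V,E)$ be the complete graph on $n\ge 2$ nodes and let $P_{\mathrm{match}}(n)=\operatorname{conv}\{\chi(M): M \text{ a matching in } K_n\}\subseteq\mathbb{R}^E$ be the Matching polytope, whose circuits are taken with respect to the linear description $$\bm{x}(E[S])\le (|S|-1)/2 \ \ \text{for all } S\subseteq V,\ |S| \text{ odd},\ |S|\ge 3;\qquad \bm{x}(\delta(v))\le 1\ \ \text{for all } v\in V;\qquad \bm{x}\ge \bm{0}.$$ Then the circuit diameter of $P_{\mathrm{match}}(n)$ is $$\mathcal{CD}(P_{\mathrm{match}}(n))=\begin{cases}1 & n=2,3,\\ 2 & n=4,5,\\ 3 & n=6,\\ 2 & n\ge 7.\end{cases}$$
   Context: For a matching (edge set) $M$, $\chi(M)\in\{0,1\}^E$ is its characteristic vector. $E[S]$ is the set of edges with both endpoints in $S$, $\delta(v)$ the set of edges incident to $v$, and $\bm{x}(F)=\sum_{e\in F}x_e$. Circuits: for a polytope $P=\{\bm{x}: A\bm{x}=\bm{b},\ B\bm{x}\le \bm{d}\}$ given by a fixed linear system, a nonzero vector $\bm{g}$ is a circuit of $P$ if $A\bm{g}=\bm{0}$ and $\operatorname{supp}(B\bm{g})$ is inclusion-minimal among the sets $\operatorname{supp}(B\bm{y})$ with $A\bm{y}=\bm{0}$, $\bm{y}\neq\bm{0}$. A point $\bm{x}''\in P$ is one circuit step from $\bm{x}'\in P$ if $\bm{x}''=\bm{x}'+\alpha\bm{c}$ for a circuit $\bm{c}$ and $\alpha>0$ maximal such that $\bm{x}'+\alpha\bm{c}\in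 P$. A circuit walk from $\bm{x}'$ to $\bm{x}''$ of length $l$ is a sequence $\bm{x}'=\bm{z}^0,\dots,\bm{z}^l=\bm{x}''$ of points of $P$ with each $\bm{z}^i$ one circuit step from $\bm{z}^{i-1}$. The circuit distance $\mathrm{cdist}(\bm{x}',\bm{x}'')$ is the length of a shortest circuit walk from $\bm{x}'$ to $\bm{x}''$ (not necessarily symmetric), and the circuit diameter $\mathcal{CD}(P)$ is the maximum circuit distance over all ordered pairs of vertices of $P$. *)

(* Defs.v *)
From HB Require Import structures.
From mathcomp Require Import all_boot all_order all_algebra.
From mathcomp Require Import reals.
Set Implicit Arguments. Unset Strict Implicit. Unset Printing Implicit Defensive.
Import Order.TTheory GRing.Theory Num.Theory.
Local Open Scope ring_scope.

Definition edge (n : nat) := {e : {set 'I_n} | #|e| == 2%N}.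

Definition vec (R : realType) (n : nat) := edge n -> R.

Definition is_matching (n : nat) (M : {set edge n}) : bool :=
  [forall e in M, forall f in M, (e != f) ==> [disjoint val e & val f]].

Definition chi (R : realType) (n : nat) (M : {set edge n}) : vec R n :=
  fun e => if e \in M then 1 else 0.

Definition xsum (R : realType) (n : nat) (x : vec R n) (F : pred (edge n)) : R :=
  \sum_(e | F e) x e.

Definition inside (n : nat) (S : {set 'I_n}) : pred (edge n) :=
  fun e => val e \subset S.
Definition delta (n : nat) (v : 'I_n) : pred (edge n) :=
  fun e => v \in val e.

Definition in_Pmatch (R : realType) (n : nat) (x : vec R n) : Prop :=
  exists lam : {set edge n} -> R,
    (forall M, 0 <= lam M) /\
    (forall M, ~~ is_matching M -> lam M = 0) /\
    \sum_(M : {set edge n}) lam M = 1 /\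
    (forall e, x e = \sum_(M : {set edge n}) lam M * chi R M e).

Definition is_vertex (R : realType) (n : nat) (x : vec R n) : Prop :=
  in_Pmatch x /\
  forall (y z : vec R n) (t : R), in_Pmatch y -> in_Pmatch z -> 0 < t -> t < 1 ->
    (forall e, x e = t * y e + (1 - t) * z e) -> forall e, y e = z e.

(* The rows of the linear description B x <= d (there are no equalities):
   x(E[S]) <= (|S|-1)/2 for S odd, |S| >= 3;  x(delta v) <= 1;  -x_e <= 0. *)
Inductive constr (n : nat) :=
  | OddSet of {set 'I_n}
  | Deg of 'I_n
  | NonNeg of edge n.

Definition is_row (n : nat) (c : constr n) : bool :=
  match c with
  | OddSet T => odd #|T| && (3 <= #|T|)%N
  | _ => true
  end.

Definition Brow (R : realType) (n : nat) (c : constr n) (g : vec R n) : R :=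
  match c with
  | OddSet T => xsum g (inside T)
  | Deg v => xsum g (delta v)
  | NonNeg e => - g e
  end.

(* right-hand sides d (not needed for circuits, recorded for completeness) *)
Definition rhs (R : realType) (n : nat) (c : constr n) : R :=
  match c with
  | OddSet T => (#|T|%:R - 1) / 2
  | Deg _ => 1
  | NonNeg _ => 0
  end.

Definition Bsupp (R : realType) (n : nat) (g : vec R n) (c : constr n) : bool :=
  is_row c && (Brow c g != 0).

Definition nonzero (R : realType) (n : nat) (g : vec R n) : Prop :=
  exists e, g e != 0.

(* circuits: nonzero g (A g = 0 is vacuous) with supp(B g) inclusion-minimal *)
Definition is_circuit (R : realType) (n : nat) (g : vec R n) : Prop :=
  nonzero g /\
  forall y : vec R n, nonzero y ->
    (forall c, Bsupp y c -> Bsupp g c) -> (forall c, Bsupp g c -> Bsupp y c).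

Definition circuit_step (R : realType) (n : nat) (x x'' : vec R n) : Prop :=
  exists (g : vec R n) (alpha : R),
    is_circuit g /\ 0 < alpha /\
    in_Pmatch (fun e => x e + alpha * g e) /\
    (forall beta, alpha < beta -> ~ in_Pmatch (fun e => x e + beta * g e)) /\
    (forall e, x'' e = x e + alpha * g e).

(* circuit walk of length l from x to y (x is assumed in P) *)
Fixpoint circuit_walk (R : realType) (n : nat) (l : nat) (x y : vec R n) : Prop :=
  match l with
  | 0%N => forall e, x e = y e
  | l'.+1 => exists z : vec R n, circuit_walk l' x z /\ circuit_step z y
  end.

Definition circuit_diameter_is (R : realType) (n : nat) (k : nat) : Prop :=
  (forall u v : vec R n, is_vertex u -> is_vertex v ->
     exists l, (l <= k)%N /\ circuit_walk l u v) /\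
  (exists u v : vec R n, is_vertex u /\ is_vertex v /\
     forall l, (l < k)%N -> ~ circuit_walk l u v).

(* Main.v *)
(** The vertices are the characteristic vectors of matchings. For matchings [M], [N]
    with difference d = chi N - chi M, the degree rows force any vector whose row
    support lies in that of d to be a multiple of d on each component of the symmetric
    difference. If e is in M minus N, f is in N minus M and w lies in a third component,
    the odd set e + f + w is not in the support of d and ties e to f. Hence with at
    least three components d is a circuit unless one matching contains the other, and
    with at most two components one switches them in turn. In the nested case with
    n >= 7 one detours through the smaller matching plus an edge joining two of the
    missing edges: a spare vertex completes the odd sets that are needed. For n = 6
    that spare vertex does not exist: any first step from the empty matching leads to a
    single edge, and from there the remaining direction to a perfect matching is
    dominated by one of its edges, so three steps are needed. *)
Require Import Defs.
From mathcomp Require Import all_boot all_order all_algebra.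
From mathcomp Require Import boolp reals lra zify.

Set Implicit Arguments.
Unset Strict Implicit.
Unset Printing Implicit Defensive.
Import Order.TTheory GRing.Theory Num.Theory.
Local Open Scope ring_scope.

Section Polytope.
Variables (R : realType) (n : nat).
Implicit Types (x y z g : vec R n) (a b c e f h k : edge n) (M N C : {set edge n}).

(** * Edges and matchings *)

Lemma edge_neq_mem e f : e != f -> exists2 v, v \in val e & v \notin val f.
Proof.
move=> ef; apply/subsetPn; apply: contraNN ef => sub.
by rewrite -val_eqE eqEcard sub (eqP (valP e)) (eqP (valP f)).
Qed.

Lemma edge_nonempty e : exists v, v \in val e.
Proof. by apply/set0Pn; rewrite -card_gt0 (eqP (valP e)). Qed.

Lemma edge_other e w : exists2 v, v \in val e & v != w.
Proof.
have /cards2P[p [q [pq eE]]] := valP e.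
have [wp|wp] := eqVneq p w; last by exists p; rewrite ?eE ?inE ?eqxx.
by exists q; rewrite ?eE ?inE ?eqxx ?orbT // -wp eq_sym.
Qed.

Lemma matching_eq M e f v :
  is_matching M -> e \in M -> f \in M -> v \in val e -> v \in val f -> e = f.
Proof.
move=> /forall_inP mM eM fM ve vf; apply/eqP; apply: contraLR ve => ef.
have /forall_inP/(_ f fM)/implyP/(_ ef) dis := mM e eM.
by rewrite (disjointFl dis vf).
Qed.

Lemma matchingP M :
  (forall e f v, e \in M -> f \in M -> v \in val e -> v \in val f -> e = f) ->
  is_matching M.
Proof.
move=> mM; apply/forall_inP => e eM; apply/forall_inP => f fM.
apply/implyP => ef; rewrite disjoints_subset; apply/subsetP => v ve.
rewrite inE; apply: contraNN ef => vf; apply/eqP; exact: mM vf.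
Qed.

(** * Vertices of the matching polytope *)

Lemma chi_ge0 M e : 0 <= chi R M e.
Proof. by rewrite /chi; case: ifP. Qed.

Lemma chi_le1 M e : chi R M e <= 1.
Proof. by rewrite /chi; case: ifP. Qed.

Lemma in_Pmatch_ge0 x e : in_Pmatch x -> 0 <= x e.
Proof.
move=> [lam [lam0 [_ [_ ->]]]]; apply: sumr_ge0 => M _.
by rewrite mulr_ge0 ?chi_ge0.
Qed.

Lemma in_Pmatch_le1 x e : in_Pmatch x -> x e <= 1.
Proof.
move=> [lam [lam0 [_ [lam1 ->]]]]; rewrite -lam1; apply: ler_sum => M _.
by rewrite ler_piMr ?chi_le1.
Qed.

Lemma in_Pmatch_chi M : is_matching M -> in_Pmatch (chi R M).
Proof.
move=> mM; exists (fun N => (N == M)%:R); split; first by move=> N; case: eqP.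
split; first by move=> N; case: eqP => // ->; rewrite mM.
split=> [|e].
  by rewrite (bigD1 M) //= eqxx big1 ?addr0 // => N /negbTE ->.
rewrite (bigD1 M) //= eqxx mul1r big1 ?addr0 // => N /negbTE ->.
by rewrite mul0r.
Qed.

(** The polytope lies in the unit cube, and 0 and 1 are extreme in [0, 1], so both points of a
    convex combination agree with [chi R M] in each coordinate. *)
Lemma vertex_chi M : is_matching M -> is_vertex (chi R M).
Proof.
move=> mM; split=> [|y z t yP zP t0 t1 E e]; first exact: in_Pmatch_chi.
have := E e; have := in_Pmatch_ge0 e yP; have := in_Pmatch_ge0 e zP.
have := in_Pmatch_le1 e yP; have := in_Pmatch_le1 e zP.
rewrite /chi; case: ifP => _; nra.
Qed.

(** Isolate one matching of positive weight in a convex representation; extremality forces the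
    renormalised rest to coincide with it. *)
Lemma vertexE x : is_vertex x -> exists2 M, is_matching M & x = chi R M.
Proof.
move=> [[lam [lam0 [lamM [lam1 lamE]]]] xtr].
have [M lM] : exists M, lam M != 0.
  apply/existsP; rewrite -negb_forall; apply/negP => /forallP lam_0.
  by move: lam1; rewrite big1 => [/eqP|N _]; [rewrite eq_sym oner_eq0 | apply/eqP].
have mM : is_matching M by apply: contraNT lM => /lamM ->.
have lMp : 0 < lam M by rewrite lt0r lM lam0.
exists M => //; apply: funext => e.
have restE : \sum_(N | N != M) lam N = 1 - lam M.
  by rewrite -lam1 [in RHS](bigD1 M) //= [lam M + _]addrC addrK.
have [lM1|lM1] := eqVneq (lam M) 1.
  have rest0 N : N != M -> lam N = 0.
    move: N; apply/psumr_eq0P; first by [].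
    by rewrite restE lM1 subrr.
  rewrite lamE (bigD1 M) //= lM1 mul1r big1 ?addr0 // => N /rest0 ->.
  by rewrite mul0r.
have lMlt : 0 < 1 - lam M.
  rewrite lt0r subr_eq0 eq_sym lM1 -restE; exact: sumr_ge0.
pose z f := \sum_(N | N != M) lam N / (1 - lam M) * chi R N f.
have zP : in_Pmatch z.
  exists (fun N => if N != M then lam N / (1 - lam M) else 0); split.
    by move=> N; case: ifP => // _; rewrite divr_ge0 // ltW.
  split; first by move=> N mN; case: ifP => // _; rewrite lamM ?mul0r.
  split=> [|f].
    by rewrite -big_mkcond -mulr_suml restE divff // gt_eqF.
  rewrite /z big_mkcond; apply: eq_bigr => N _.
  by case: ifP => _ //; rewrite mul0r.
have xE f : x f = lam M * chi R M f + (1 - lam M) * z f.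
  rewrite lamE (bigD1 M) //=; congr (_ + _); rewrite /z mulr_sumr.
  apply: eq_bigr => N _; rewrite mulrA [_ * (lam N / _)]mulrC divfK //.
  by rewrite gt_eqF.
have yz : forall f, chi R M f = z f.
  apply: (xtr _ _ (lam M)) => //; [exact: in_Pmatch_chi | by rewrite -subr_gt0].
by rewrite xE -yz -mulrDl addrC subrK mul1r.
Qed.

(** * Circuits joining two matchings *)

Definition dchi M N : vec R n := fun e => chi R N e - chi R M e.

Definition symdiff M N := (M :\: N) :|: (N :\: M).

Lemma in_symdiff M N e : (e \in symdiff M N) = ((e \in M) != (e \in N)).
Proof. by rewrite !inE; do 2 case: (e \in _). Qed.

Lemma dchi_eq0 M N e : (dchi M N e == 0) = (e \notin symdiff M N).
Proof.
rewrite in_symdiff /dchi /chi; do 2 case: (e \in _);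
by rewrite ?subrr ?sub0r ?subr0 ?oppr_eq0 ?oner_eq0 ?eqxx.
Qed.

Lemma dchi_sq M N e : e \in symdiff M N -> dchi M N e * dchi M N e = 1.
Proof.
rewrite in_symdiff /dchi /chi; do 2 case: (e \in _) => //=; lra.
Qed.

Lemma symdiff_neq0 M N : M != N -> exists e, e \in symdiff M N.
Proof.
move=> MN; apply/set0Pn; apply: contraNN MN => /eqP D0; apply/eqP/setP => e.
by apply/eqP; have := in_symdiff M N e; rewrite D0 inE => /esym/negbFE.
Qed.

(** * Domination of row supports *)

Definition dominated y g := forall c : constr n, Bsupp y c -> Bsupp g c.

Lemma dominated_row y g (c : constr n) : dominated y g -> is_row c -> Brow c g = 0 -> Brow c y = 0.
Proof.
move=> dyg rc g0; apply/eqP/negPn/negP => y0.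
by have := dyg c; rewrite /Bsupp rc y0 g0 eqxx => /(_ isT).
Qed.

Lemma dominated_supp y g e : dominated y g -> g e = 0 -> y e = 0.
Proof.
move=> dyg ge; have := @dominated_row _ _ (NonNeg e) dyg isT; rewrite /= ge oppr0.
by move=> /(_ erefl)/eqP; rewrite oppr_eq0 => /eqP.
Qed.

Lemma Bsupp_scale (a : R) x y : a != 0 -> (forall e, x e = a * y e) ->
  forall c : constr n, Bsupp x c = Bsupp y c.
Proof.
move=> a0 xE c; rewrite /Bsupp; congr (_ && ~~ _).
have sumE F : xsum x F = a * xsum y F.
  by rewrite /xsum mulr_sumr; apply: eq_bigr => e _.
by case: c => [T|v|e]; rewrite /= ?sumE ?xE -?mulrN mulf_eq0 (negbTE a0).
Qed.

Lemma circuit_scale (a : R) x y : a != 0 -> (forall e, x e = a * y e) ->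
  is_circuit y -> is_circuit x.
Proof.
move=> a0 xE [[e ye] ymin]; split; first by exists e; rewrite xE mulf_neq0.
move=> z z0 dz c; rewrite (Bsupp_scale a0 xE) => /ymin; apply => // c'.
by rewrite -(Bsupp_scale a0 xE); apply: dz.
Qed.

Lemma circuit_dchiC M N : is_circuit (dchi M N) -> is_circuit (dchi N M).
Proof.
apply: (@circuit_scale (-1)); first by rewrite oppr_eq0 oner_eq0.
by move=> e; rewrite mulN1r opprB.
Qed.

Lemma xsum2 x (F : pred (edge n)) e f : e != f -> F e -> F f ->
  (forall h, F h -> h != e -> h != f -> x h = 0) -> xsum x F = x e + x f.
Proof.
move=> ef Fe Ff x0; rewrite /xsum (bigD1 e) //= (bigD1 f) /=; last first.
  by rewrite Ff eq_sym.
rewrite big1 ?addr0 // => h /andP[/andP[Fh he] hf]; exact: x0.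
Qed.

(* [dchi] squares to 1 on the symmetric difference, so [y e * dchi M N e] is the
   local ratio of [y] to [dchi M N] at [e]. *)
Lemma circuit_of_const M N : M != N ->
  (forall y e f, dominated y (dchi M N) -> e \in symdiff M N ->
     f \in symdiff M N -> y e * dchi M N e = y f * dchi M N f) ->
  is_circuit (dchi M N).
Proof.
move=> MN const; have [e0 De0] := symdiff_neq0 MN.
split; first by exists e0; rewrite dchi_eq0 De0.
move=> y [e1 ye1] dy.
have De1 : e1 \in symdiff M N.
  apply: contraNT ye1; rewrite -dchi_eq0 => /eqP d0.
  by rewrite (dominated_supp dy).
pose t := y e1 * dchi M N e1.
have t0 : t != 0 by rewrite mulf_neq0 // dchi_eq0 De1.
have yE e : y e = t * dchi M N e.
  have [De|] := boolP (e \in symdiff M N).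
    by rewrite /t -(const y e) // -mulrA dchi_sq // mulr1.
  rewrite -dchi_eq0 => /eqP d0; rewrite d0 mulr0; exact: dominated_supp d0.
by move=> c; rewrite (Bsupp_scale t0 yE).
Qed.

(** Of two distinct edges of the symmetric difference that meet at [v], one is in [M] and the other
    in [N]. The degree row at [v] thus vanishes on [dchi M N], hence on [y]. *)
Lemma const_adjacent M N y e f v : is_matching M -> is_matching N ->
  dominated y (dchi M N) -> e \in symdiff M N -> f \in symdiff M N ->
  v \in val e -> v \in val f -> y e * dchi M N e = y f * dchi M N f.
Proof.
move=> mM mN dy De Df ve vf; have [->//|ef] := eqVneq e f.
have out h : delta v h -> h != e -> h != f -> dchi M N h = 0.
  rewrite /delta => vh he hf; apply/eqP; rewrite dchi_eq0; apply/negP => Dh.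
  have eqM a b := @matching_eq M a b v mM; have eqN a b := @matching_eq N a b v mN.
  (* Among three edges through [v], two would belong to the same matching and so coincide. *)
  move: De Df Dh ef he hf; rewrite !in_symdiff.
  case eM: (e \in M); case eN: (e \in N) => //= _;
  case fM: (f \in M); case fN: (f \in N) => //= _;
  case hM: (h \in M); case hN: (h \in N) => //= _;
  by first [case/eqP; exact: eqM | case/eqP; exact: eqN
    | move=> _ /eqP[]; exact: eqM | move=> _ /eqP[]; exact: eqN
    | move=> _ _ /eqP[]; exact: eqM | move=> _ _ /eqP[]; exact: eqN].
have d0 : dchi M N e + dchi M N f = 0.
  move: De Df; rewrite !in_symdiff /dchi /chi.
  case eM: (e \in M); case eN: (e \in N) => //= _;
  case fM: (f \in M); case fN: (f \in N) => //= _; try lra.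
    by case/eqP: ef; apply: matching_eq mM _ _ ve vf.
  by case/eqP: ef; apply: matching_eq mN _ _ ve vf.
have y0 : y e + y f = 0.
  rewrite -(@xsum2 y (delta v) e f) //; last first.
    by move=> h vh he hf; apply: dominated_supp dy _; apply: out.
  apply: (@dominated_row _ _ (Deg v) dy) => //=.
  by rewrite (xsum2 ef).
by rewrite -(addr0_eq y0) -(addr0_eq d0) mulrNN.
Qed.

(** The row of the five-vertex set formed by [e], [f] and [w] gives -1 + 1 = 0 on [dchi M N], which
    forces [y e + y f = 0]. *)
Lemma const_oddset M N y e f w :
  dominated y (dchi M N) -> e \in M :\: N -> f \in N :\: M ->
  [disjoint val e & val f] -> w \notin val e -> w \notin val f ->
  (forall h, h \in symdiff M N -> val h \subset w |: (val e :|: val f) ->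
     (h == e) || (h == f)) ->
  y e * dchi M N e = y f * dchi M N f.
Proof.
rewrite !inE => dy /andP[/negbTE eN eM] /andP[/negbTE fM fN] dis we wf out.
pose S := w |: (val e :|: val f).
have ef : e != f by apply/eqP => ef; rewrite ef fM in eM.
have rS : is_row (OddSet S).
  rewrite /= cardsU1 !inE (negbTE we) (negbTE wf) /=.
  by rewrite cardsU disjoint_setI0 // cards0 (eqP (valP e)) (eqP (valP f)).
have eS : inside S e by apply/subsetP => v; rewrite !inE => ->; rewrite orbT.
have fS : inside S f by apply/subsetP => v; rewrite !inE => ->; rewrite !orbT.
have outd h : inside S h -> h != e -> h != f -> dchi M N h = 0.
  move=> hS /negbTE he /negbTE hf; apply/eqP; rewrite dchi_eq0; apply/negP => Dh.
  by have := out h Dh hS; rewrite he hf.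
have de : dchi M N e = -1 by rewrite /dchi /chi eM eN sub0r.
have df : dchi M N f = 1 by rewrite /dchi /chi fM fN subr0.
have y0 : y e + y f = 0.
  rewrite -(@xsum2 y (inside S) e f) //; last first.
    by move=> h vh he hf; apply: dominated_supp dy _; apply: outd.
  apply: (@dominated_row _ _ (OddSet S) dy) => //=.
  by rewrite (xsum2 ef) // de df addNr.
by rewrite de df mulrN1 mulr1; apply/eqP; rewrite eq_sym -addr_eq0 addrC y0.
Qed.

(** * Components of the symmetric difference *)

Definition adj C : rel (edge n) :=
  fun e f => [&& e \in C, f \in C & ~~ [disjoint val e & val f]].

Lemma adj_sym C : symmetric (adj C).
Proof. by move=> e f; rewrite /adj disjoint_sym andbCA. Qed.

Lemma adj_mem C e f v : e \in C -> f \in C -> v \in val e -> v \in val f -> adj C e f.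
Proof.
move=> eC fC ve vf; rewrite /adj eC fC; apply/negP => dis.
by rewrite (disjointFr dis ve) in vf.
Qed.

Lemma unconnected_disjoint C e f : e \in C -> f \in C ->
  ~~ connect (adj C) e f -> [disjoint val e & val f].
Proof. by move=> eC fC; apply: contraNT => ndis; rewrite connect1 // /adj eC fC. Qed.

(** Equality of ratios propagates along paths. The set [C] carrying the paths may exceed the
    symmetric difference, so that the components of a difference can still be used after a switch
    has shrunk it. *)
Lemma const_connected M N C y e f : is_matching M -> is_matching N ->
  dominated y (dchi M N) -> closed (adj C) (mem (symdiff M N)) ->
  e \in symdiff M N -> connect (adj C) e f ->
  y e * dchi M N e = y f * dchi M N f.
Proof.
move=> mM mN dy clD De ef.
pose a := [pred h | (h \in symdiff M N) &&
                    (y e * dchi M N e == y h * dchi M N h)].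
have aE h : (h \in a) = (h \in symdiff M N) && (y e * dchi M N e == y h * dchi M N h).
  by [].
suff cla : closed (adj C) a.
  have := closed_connect cla ef; rewrite !aE De eqxx /=.
  by move=> /esym/andP[_ /eqP].
move=> h k hk; have := clD _ _ hk; rewrite !aE => ->.
have [Dk|//] := boolP (k \in symdiff M N); congr (_ == _).
have Dh : h \in symdiff M N by have := clD _ _ hk; rewrite Dk.
case/and3P: hk => _ _; rewrite -setI_eq0 => /set0Pn[v].
by rewrite inE => /andP[vh vk]; apply: const_adjacent vh vk.
Qed.

Lemma circuit_of_connected M N C e : is_matching M -> is_matching N ->
  closed (adj C) (mem (symdiff M N)) -> e \in symdiff M N ->
  (forall f, f \in symdiff M N -> connect (adj C) e f) -> is_circuit (dchi M N).
Proof.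
move=> mM mN clD De conn; apply: circuit_of_const => [|y f h dy Df Dh].
  by apply: contraTneq De => ->; rewrite in_symdiff eqxx.
rewrite -(const_connected mM mN dy clD De (conn f Df)).
by rewrite -(const_connected mM mN dy clD De (conn h Dh)).
Qed.

(** A further component supplies the vertex [w] of an odd set tying an edge of [M :\: N] to one of
    [N :\: M]. Both sides are nonempty, so two edges on the same side are compared through one on
    the other side. *)
Lemma circuit_of_three_components M N : is_matching M -> is_matching N ->
  ~~ (M \subset N) -> ~~ (N \subset M) ->
  (forall e f, e \in symdiff M N -> f \in symdiff M N ->
     exists2 h, h \in symdiff M N &
       ~~ connect (adj (symdiff M N)) e h && ~~ connect (adj (symdiff M N)) f h) ->
  is_circuit (dchi M N).
Proof.
move=> mM mN /subsetPn[e0 e0M e0N] /subsetPn[f0 f0N f0M] three.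
set D := symdiff M N in three *.
have clD : closed (adj D) (mem D) by move=> h k /and3P[-> -> _].
have MD e : e \in M -> e \notin N -> e \in D by rewrite in_symdiff => -> /negbTE ->.
have ND e : e \in N -> e \notin M -> e \in D by rewrite in_symdiff => -> /negbTE ->.
have csym : connect_sym (adj D) by apply/sym_connect_sym/adj_sym.
apply: circuit_of_const => [|y e f dy De Df].
  by apply: contraNneq e0N => <-.
have cross a b : a \in M -> a \notin N -> b \in N -> b \notin M ->
    y a * dchi M N a = y b * dchi M N b.
  move=> aM aN bN bM; have [ab|nab] := boolP (connect (adj D) a b).
    by apply: const_connected ab => //; apply: MD.
  have Da := MD a aM aN; have Db := ND b bN bM.
  have [h Dh /andP[ah bh]] := three a b Da Db.
  have [w wh] := edge_nonempty h.
  apply: (const_oddset (w := w)) => //; rewrite ?inE ?aM ?aN ?bM ?bN //.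
  - exact: unconnected_disjoint nab.
  - by rewrite (disjointFl (unconnected_disjoint Da Dh ah)).
  - by rewrite (disjointFl (unconnected_disjoint Db Dh bh)).
  (* A third edge [k] in the odd set would meet two of [a], [b], [h] (the last one at [w]) and so
     link two different components. *)
  move=> k Dk /subsetP kS; apply: contraT; rewrite negb_or => /andP[ka kb].
  have link (c : edge n) (v : 'I_n) : v \in val k -> v \in val c -> c \in D -> connect (adj D) c k.
    by move=> vk vc Dc; apply/connect1/(adj_mem Dc Dk vc vk).
  have [u uk ua] := edge_neq_mem ka; have [v vk vb] := edge_neq_mem kb.
  have := kS u uk; have := kS v vk; rewrite !inE (negbTE ua) (negbTE vb) orbF /=.
  case/orP=> [/eqP vw|va]; case/orP=> [/eqP uw|ub].
  + subst u v; have [x xk xw] := edge_other k w.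
    have := kS x xk; rewrite !inE (negbTE xw) /= => /orP[xa|xb].
      case/negP: ah; apply: connect_trans (link a x xk xa Da) _.
      by rewrite csym; apply: (link h w).
    case/negP: bh; apply: connect_trans (link b x xk xb Db) _.
    by rewrite csym; apply: (link h w).
  + subst v; case/negP: bh; apply: connect_trans (link b u uk ub Db) _.
    by rewrite csym; apply: (link h w).
  + subst u; case/negP: ah; apply: connect_trans (link a v vk va Da) _.
    by rewrite csym; apply: (link h w).
  case/negP: nab; apply: connect_trans (link a v vk va Da) _.
  by rewrite csym; apply: (link b u).
move: De Df; rewrite !in_symdiff.
case eM: (e \in M); case eN: (e \in N) => //= _;
case fM: (f \in M); case fN: (f \in N) => //= _.
- by rewrite !(cross _ f0) ?eM ?eN ?fM ?fN.
- by rewrite (cross _ f) ?eM ?eN ?fM ?fN.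
- by rewrite -(cross f) ?eM ?eN ?fM ?fN.
- by rewrite -!(cross e0) ?eM ?eN ?fM ?fN.
Qed.

(** * Switching a matching on a union of components *)

Definition switch M N C := (M :\: C) :|: (N :&: C).

(** A kept edge of [M] outside [N] cannot meet an edge brought in from [N]: the two would be
    adjacent in the symmetric difference, and closedness would put the kept one in [C]. *)
Lemma switch_matching M N C : is_matching M -> is_matching N ->
  C \subset symdiff M N -> closed (adj (symdiff M N)) (mem C) ->
  is_matching (switch M N C).
Proof.
move=> mM mN /subsetP CD clC.
have mix a b v : a \in M -> a \notin C -> b \in N -> b \in C ->
    v \in val a -> v \in val b -> a = b.
  move=> aM aC bN bC va vb; have [aN|aN] := boolP (a \in N).
    exact: (matching_eq mN) va vb.
  have Da : a \in symdiff M N by rewrite in_symdiff aM (negbTE aN).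
  have := clC _ _ (adj_mem Da (CD b bC) va vb); rewrite /= bC => aC'.
  by rewrite aC' in aC.
apply: matchingP => e f v; rewrite !inE.
move=> /orP[/andP[eC eM]|/andP[eN eC]] /orP[/andP[fC fM]|/andP[fN fC]] ve vf.
- exact: (matching_eq mM) ve vf.
- exact: mix ve vf.
- by symmetry; apply: mix vf ve.
- exact: (matching_eq mN) ve vf.
Qed.

Lemma symdiff_switchl M N C : C \subset symdiff M N -> symdiff M (switch M N C) = C.
Proof.
move=> /subsetP CD; apply/setP => e; have := CD e; rewrite in_symdiff !inE.
by do 3 case: (e \in _) => //=; move=> /(_ isT).
Qed.

Lemma symdiff_switchr M N C : symdiff (switch M N C) N = symdiff M N :\: C.
Proof. by apply/setP => e; rewrite !inE; do 3 case: (e \in _). Qed.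

(** * From circuits to steps and walks *)

Lemma step_of_circuit M N : is_matching M -> is_matching N ->
  is_circuit (dchi M N) -> circuit_step (chi R M) (chi R N).
Proof.
move=> mM mN cMN; exists (dchi M N), 1; do 2 split => //.
have NE e : chi R N e = chi R M e + 1 * dchi M N e by rewrite mul1r addrC subrK.
have -> : (fun e => chi R M e + 1 * dchi M N e) = chi R N.
  by apply: funext => e; rewrite -NE.
split; first exact: in_Pmatch_chi.
(* Length 1 is maximal: where the direction is nonzero, the coordinate already runs from one end of
   [0, 1] to the other. *)
split=> // b b1 bP; have [[e de] _] := cMN.
have := in_Pmatch_ge0 e bP; have := in_Pmatch_le1 e bP.
move: de; rewrite /dchi /chi; do 2 case: ifP => _; rewrite ?subrr ?eqxx //; lra.
Qed.

Lemma walk_trans (k l : nat) x y z :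
  circuit_walk k x y -> circuit_walk l y z -> circuit_walk (l + k) x z.
Proof.
move=> xy; elim: l z => [|l IH] z /=; first by move=> /funext <-.
by move=> [w [yw wz]]; exists w; split => //; apply: IH.
Qed.

Lemma walk1 x y : circuit_step x y -> circuit_walk 1 x y.
Proof. by move=> xy; exists x. Qed.

(** * Upper bounds *)

(** The switch changes [M] exactly on [C], which is connected, so its direction is a circuit. *)
Lemma component_switch M N e : is_matching M -> is_matching N -> e \in symdiff M N ->
  let C := [set h in symdiff M N | connect (adj (symdiff M N)) e h] in
  [/\ is_matching (switch M N C), circuit_step (chi R M) (chi R (switch M N C)),
      closed (adj (symdiff M N)) (mem C) & symdiff (switch M N C) N = symdiff M N :\: C].
Proof.
move=> mM mN De; set D := symdiff M N in De *; move=> C.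
have CD : C \subset D by apply/subsetP => h; rewrite inE => /andP[].
have csym : connect_sym (adj D) by apply/sym_connect_sym/adj_sym.
have clC : closed (adj D) (mem C).
  move=> h k hk; rewrite /= ![_ \in C]in_set; case/and3P: (hk) => -> -> _ /=.
  exact: (same_connect1r csym hk).
have mS := switch_matching mM mN CD clC.
split=> //; last exact: symdiff_switchr.
apply: step_of_circuit => //.
have DE : symdiff M (switch M N C) = C by apply: symdiff_switchl.
apply: (circuit_of_connected (C := D) (e := e)) => //; rewrite ?DE //.
  by rewrite inE De connect0.
by move=> f; rewrite inE => /andP[].
Qed.

(** One or two components: [e] and [f] may coincide. *)
Definition few_components M N := [exists e in symdiff M N, exists f in symdiff M N,
  forall h in symdiff M N,
    connect (adj (symdiff M N)) e h || connect (adj (symdiff M N)) f h].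

Lemma many_components M N e f : ~~ few_components M N ->
  e \in symdiff M N -> f \in symdiff M N ->
  exists2 h, h \in symdiff M N &
    ~~ connect (adj (symdiff M N)) e h && ~~ connect (adj (symdiff M N)) f h.
Proof.
move=> + De Df; rewrite negb_exists_in => /forall_inP/(_ e De).
rewrite negb_exists_in => /forall_inP/(_ f Df).
by rewrite negb_forall_in => /exists_inP[h Dh]; rewrite negb_or; exists h.
Qed.

Lemma many_components_disjoint M N : M != N -> ~~ few_components M N ->
  exists e f h, [/\ e \in symdiff M N, f \in symdiff M N & h \in symdiff M N] /\
    [/\ [disjoint val e & val f], [disjoint val e & val h] & [disjoint val f & val h]].
Proof.
move=> MN many; have [e De] := symdiff_neq0 MN.
have [f Df /andP[ef _]] := many_components many De De.
have [h Dh /andP[eh fh]] := many_components many De Df.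
by exists e, f, h; split => //; split; apply: (unconnected_disjoint (C := symdiff M N)).
Qed.

Lemma walk_few M N : is_matching M -> is_matching N -> few_components M N ->
  exists l, (l <= 2)%N /\ circuit_walk l (chi R M) (chi R N).
Proof.
move=> mM mN /exists_inP[e De /exists_inP[f Df /forall_inP cov]].
have [] := component_switch mM mN De; set D := symdiff M N in De Df cov *.
set C := [set h in _ | _]; set M' := switch _ _ _ => mM' step clC DE.
have csym : connect_sym (adj D) by apply/sym_connect_sym/adj_sym.
have [M'N|M'N] := eqVneq M' N.
  by exists 1%N; split => //; rewrite -M'N; apply: walk1.
exists 2%N; split => //; apply: (@walk_trans 1 1 _ (chi R M')); apply: walk1 => //.
apply: step_of_circuit => //; have [h Dh] := symdiff_neq0 M'N.
(* What remains after the first switch lies in the component of [f]; connectivity is still measured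
   in the original difference [D]. *)
have fconn k : k \in symdiff M' N -> connect (adj D) f k.
  rewrite DE in_setD [k \in C]in_set => /andP[+ Dk]; rewrite Dk /=.
  by have := cov k Dk; case: (connect _ e k).
apply: (circuit_of_connected (C := D) (e := h)) => //.
  move=> k1 k2 kk; have := clC _ _ kk; rewrite /= DE !in_setD => ->.
  by case/and3P: kk => -> ->.
move=> k Dk; apply: connect_trans (fconn k Dk); rewrite csym; exact: fconn.
Qed.

(** * Bounds for small [n] by counting the vertices of disjoint edges *)

Lemma edge_cardU2 e f : [disjoint val e & val f] -> #|val e :|: val f| = 4%N.
Proof.
by move=> ef; rewrite cardsU disjoint_setI0 // cards0 (eqP (valP e)) (eqP (valP f)).
Qed.

Lemma edge_cardU3 e f h : [disjoint val e & val f] -> [disjoint val e & val h] ->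
  [disjoint val f & val h] -> #|val e :|: val f :|: val h| = 6%N.
Proof.
move=> ef eh fh; rewrite cardsU setIUl !disjoint_setI0 // setU0 cards0.
by rewrite edge_cardU2 // (eqP (valP h)).
Qed.

Lemma edge_cardU4 e f h k : [disjoint val e & val f] -> [disjoint val e & val h] ->
  [disjoint val f & val h] -> [disjoint val e & val k] -> [disjoint val f & val k] ->
  [disjoint val h & val k] -> #|val e :|: val f :|: val h :|: val k| = 8%N.
Proof.
move=> ef eh fh ek fk hk; rewrite cardsU !setIUl !disjoint_setI0 // !setU0 cards0.
by rewrite edge_cardU3 // (eqP (valP k)).
Qed.

Lemma card_verts (A : {set 'I_n}) : (#|A| <= n)%N.
Proof. by rewrite -[X in (_ <= X)%N]card_ord max_card. Qed.

(** Two components would contain disjoint edges, hence four vertices, so the difference is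
    connected. *)
Lemma step_le3 M N : (n <= 3)%N -> is_matching M -> is_matching N -> M != N ->
  circuit_step (chi R M) (chi R N).
Proof.
move=> n3 mM mN MN; apply: step_of_circuit => //.
have [e De] := symdiff_neq0 MN.
apply: (circuit_of_connected (C := symdiff M N) (e := e)) => //.
  by move=> h k /and3P[/= -> ->].
move=> f Df; apply: contraT => /(unconnected_disjoint De Df) /edge_cardU2 ef.
by have := card_verts (val e :|: val f); rewrite ef => /leq_trans/(_ n3).
Qed.

Lemma walk_le5 M N : (n <= 5)%N -> is_matching M -> is_matching N ->
  exists l, (l <= 2)%N /\ circuit_walk l (chi R M) (chi R N).
Proof.
move=> n5 mM mN; have [->|MN] := eqVneq M N; first by exists 0%N.
have [few|many] := boolP (few_components M N); first exact: walk_few.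
have [e [f [h [_ [ef eh fh]]]]] := many_components_disjoint MN many.
have := card_verts (val e :|: val f :|: val h).
by rewrite edge_cardU3 // => /leq_trans/(_ n5).
Qed.

(** Switch one component first. If more than two components were left, they would yield with the
    first one four disjoint edges, on eight vertices. *)
Lemma walk_le7 M N : (n <= 7)%N -> is_matching M -> is_matching N ->
  exists l, (l <= 3)%N /\ circuit_walk l (chi R M) (chi R N).
Proof.
move=> n7 mM mN; have [->|MN] := eqVneq M N; first by exists 0%N.
have [e De] := symdiff_neq0 MN; have [] := component_switch mM mN De.
set D := symdiff M N in De *.
set C := [set h in _ | _]; set M' := switch _ _ _ => mM' step clC DE.
suff [l [l2 wl]] : exists l, (l <= 2)%N /\ circuit_walk l (chi R M') (chi R N).
  exists l.+1; split => //; rewrite -addn1; exact: walk_trans (walk1 step) wl.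
have [->|M'N] := eqVneq M' N; first by exists 0%N.
have [few|many] := boolP (few_components M' N); first exact: walk_few.
have [f [h [k [[Df Dh Dk] [fh fk hk]]]]] := many_components_disjoint M'N many.
have edis a : a \in symdiff M' N -> [disjoint val e & val a].
  rewrite DE in_setD => /andP[aC aD]; apply: (unconnected_disjoint De aD).
  by apply: contraNN aC => ea; rewrite inE aD.
have := card_verts (val e :|: val f :|: val h :|: val k).
by rewrite edge_cardU4 ?edis // => /leq_trans/(_ n7).
Qed.

(** * Detours between nested matchings *)

Definition mk_edge (a b : 'I_n) (ab : a != b) : edge n :=
  exist (fun e : {set 'I_n} => #|e| == 2%N) [set a; b]
    (introT eqP (etrans (cards2 a b) (congr1 (fun c : bool => c.+1) ab))).

Lemma circuit_singleton M e : e \notin M -> is_circuit (dchi M (e |: M)).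
Proof.
move=> eM; have DE : symdiff M (e |: M) = [set e].
  apply/setP => f; rewrite in_symdiff !inE; have [->|_] := eqVneq f e => /=.
    by rewrite (negbTE eM).
  by rewrite eqxx.
apply: circuit_of_const => [|y a b _]; last by rewrite DE !inE => /eqP -> /eqP ->.
by apply: contraNneq eM => ->; rewrite setU11.
Qed.

(* [e] joins [e1] to [e2]; since n >= 7 there is a vertex [w] off [e1], [e2] and
   any third edge [f] of [N], so that the odd set e :|: f :|: [set w] ties [f] to [e]. *)
Lemma subset_detour M N : (7 <= n)%N -> is_matching M -> is_matching N ->
  M \subset N -> (1 < #|N :\: M|)%N ->
  exists M', [/\ is_matching M', is_circuit (dchi M M') & is_circuit (dchi M' N)].
Proof.
move=> n7 mM mN /subsetP MN /card_gt1P[e1 [e2 []]].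
rewrite !inE => /andP[e1M e1N] /andP[e2M e2N] e12.
have [b1 b1e1] := edge_nonempty e1; have [a2 a2e2] := edge_nonempty e2.
have b12 : b1 != a2.
  by apply: contraNneq e12 => b12; apply/eqP/(matching_eq mN e1N e2N b1e1); rewrite b12.
pose e := mk_edge b12.
have eE : val e = [set b1; a2] by [].
have b1e : b1 \in val e by rewrite eE !inE eqxx.
have a2e : a2 \in val e by rewrite eE !inE eqxx orbT.
have meet h v : h \in N -> v \in val h -> v \in val e -> h = e1 \/ h = e2.
  move=> hN vh; rewrite eE !inE => /orP[]/eqP vE; subst v.
    by left; apply: matching_eq mN _ _ vh _.
  by right; apply: matching_eq mN _ _ vh _.
have eN : e \notin N.
  apply: contraNN e12 => eN; have E1 := matching_eq mN eN e1N b1e b1e1.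
  by have E2 := matching_eq mN eN e2N a2e a2e2; rewrite -E1 -E2.
have eM : e \notin M by apply: contraNN eN; apply: MN.
have mM' : is_matching (e |: M).
  have eoff h v : h \in M -> v \in val h -> v \in val e -> e = h.
    move=> hM vh ve; have [hE|hE] := meet h v (MN h hM) vh ve.
      by rewrite -hE hM in e1M.
    by rewrite -hE hM in e2M.
  apply: matchingP => f h v; rewrite !inE => /orP[/eqP ->|fM] /orP[/eqP ->|hM] vf vh //.
  - exact: eoff vh vf.
  - by symmetry; apply: eoff vf vh.
  - exact: matching_eq mM fM hM vf vh.
exists (e |: M); split => //; first exact: circuit_singleton.
have inD h : (h \in symdiff (e |: M) N) = (h == e) || (h \in N) && (h \notin M).
  rewrite in_symdiff !inE; have [->|_] := eqVneq h e => /=; first by rewrite eN.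
  by have := MN h; case: (h \in M); case: (h \in N) => // /(_ isT).
have De : e \in symdiff (e |: M) N by rewrite inD eqxx.
apply: circuit_of_const => [|y f h dy Df Dh].
  by apply: contraNneq eN => <-; rewrite setU11.
suff toe k : k \in symdiff (e |: M) N ->
    y e * dchi (e |: M) N e = y k * dchi (e |: M) N k by rewrite -!toe.
move=> {f h Df Dh} Df; have := Df; rewrite inD => /orP[/eqP -> //|/andP[fN fM]].
move: k Df fN fM => f Df fN fM.
(* The edges [e1] and [e2] share a vertex with [e], so degree rows tie them to it; odd sets serve
   for the other edges. *)
have [fe1|fe1] := eqVneq f e1; first by apply: (const_adjacent (v := b1)); rewrite ?fe1 // -fe1.
have [fe2|fe2] := eqVneq f e2; first by apply: (const_adjacent (v := a2)); rewrite ?fe2 // -fe2.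
have dis : [disjoint val e & val f].
  rewrite -setI_eq0; apply/set0Pn => -[v]; rewrite inE => /andP[ve vf].
  by have [E|E] := meet f v fN vf ve; [move: fe1 | move: fe2]; rewrite E eqxx.
have [w] : exists w, w \notin val e1 :|: val e2 :|: val f.
  have : (#|val e1 :|: val e2 :|: val f| < n)%N.
    apply: leq_ltn_trans n7; apply: leq_trans (leq_card_setU _ _) _.
    rewrite (eqP (valP f)) (leq_add2r 2 _ 4); apply: leq_trans (leq_card_setU _ _) _.
    by rewrite (eqP (valP e1)) (eqP (valP e2)).
  rewrite -[X in (_ < X)%N]card_ord -cardsT => cl.
  have : ~~ ([set: 'I_n] \subset val e1 :|: val e2 :|: val f).
    by apply/negP => /subset_leq_card; rewrite leqNgt cl.
  by move=> /subsetPn[w _ wn]; exists w.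
rewrite !inE !negb_or => /andP[/andP[we1 we2] wf].
apply: (const_oddset (w := w)) => //.
- by rewrite !inE eqxx eN.
- by rewrite !inE fN (negbTE fM) orbF andbT; apply: contraNneq eN => <-.
- rewrite eE !inE negb_or.
  by apply/andP; split; [apply: contraNneq we1 => -> | apply: contraNneq we2 => ->].
(* An edge [k] of [N] other than [f] is disjoint from [f], so inside the odd set it would join [w]
   to an end of [e]. Then [k] is [e1] or [e2], and these avoid [w]. *)
move=> k; rewrite inD => /orP[-> //|/andP[kN kM]] /subsetP kS.
have [-> //|ke] := eqVneq k e; have [//|kf] := eqVneq k f.
have kSe v : v \in val k -> (v == w) || (v \in val e).
  move=> vk; have := kS v vk; rewrite 3!inE => /or3P[->|->|vf] //; first by rewrite orbT.
  by case/eqP: kf; apply: matching_eq mN kN fN vk vf.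
have [v vk vw] := edge_other k w.
have := kSe v vk; rewrite (negbTE vw) /= => ve.
have [u uk ue] := edge_neq_mem ke.
have := kSe u uk; rewrite (negbTE ue) orbF => /eqP uw; subst u.
have [kE|kE] := meet k v kN vk ve; first by rewrite -kE uk in we1.
by rewrite -kE uk in we2.
Qed.

Lemma symdiffC M N : symdiff M N = symdiff N M.
Proof. exact: setUC. Qed.

Lemma edges_disjoint_neq e f : [disjoint val e & val f] -> e != f.
Proof.
move=> dis; have [v ve] := edge_nonempty e.
by apply: contraFneq (disjointFr dis ve) => <-.
Qed.

Lemma walk_ge7 M N : (7 <= n)%N -> is_matching M -> is_matching N ->
  exists l, (l <= 2)%N /\ circuit_walk l (chi R M) (chi R N).
Proof.
move=> n7 mM mN; have [->|MN] := eqVneq M N; first by exists 0%N.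
have [few|many] := boolP (few_components M N); first exact: walk_few.
have two M' : is_matching M' -> is_circuit (dchi M M') -> is_circuit (dchi M' N) ->
    exists l, (l <= 2)%N /\ circuit_walk l (chi R M) (chi R N).
  move=> mM' c1 c2; exists 2%N; split => //.
  by apply: (@walk_trans 1 1 _ (chi R M')); apply/walk1/step_of_circuit.
(* For nested matchings the symmetric difference is [B :\: A], and its several components give two
   distinct edges. *)
have large A B : symdiff A B = symdiff M N -> A \subset B -> (1 < #|B :\: A|)%N.
  rewrite {1}/symdiff -setD_eq0 => + /eqP AB; rewrite AB set0U => ->.
  have [e [f [_ [[De Df _] [/edges_disjoint_neq ef _ _]]]]] :=
    many_components_disjoint MN many.
  by apply/card_gt1P; exists e, f.
have [sMN|nMN] := boolP (M \subset N).
  have [M' [mM' c1 c2]] := subset_detour n7 mM mN sMN (large _ _ erefl sMN).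
  exact: two c1 c2.
have [sNM|nNM] := boolP (N \subset M).
  have [M' [mM' c1 c2]] := subset_detour n7 mN mM sNM (large _ _ (symdiffC _ _) sNM).
  (* The detour is built from [N] to [M] and traversed backwards, since circuits survive a change of
     sign. *)
  by apply: (two M') => //; apply: circuit_dchiC.
exists 1%N; split => //; apply/walk1/step_of_circuit => //.
by apply: circuit_of_three_components => // e f De Df; apply: many_components.
Qed.

(** * Lower bounds *)

(** The hypotheses make every row that is nonzero on [chi R [set e]] nonzero on [g]. Minimality
    reverses this inclusion, and the rows [NonNeg] then leave [g] no other coordinate. *)
Lemma circuit_dominating_edge g e : is_circuit g -> g e != 0 ->
  (forall v, v \in val e -> xsum g (delta v) != 0) ->
  (forall T : {set 'I_n}, odd #|T| -> val e \subset T -> xsum g (inside T) != 0) ->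
  forall f, f != e -> g f = 0.
Proof.
move=> [_ gmin] ge gv gT f fe.
have chi0 F : xsum (chi R [set e]) F != 0 -> F e.
  apply: contraR => Fe; rewrite /xsum big1 // => h Fh; rewrite /chi inE.
  by case: eqP => // he; rewrite -he Fh in Fe.
have /(_ _ _ (NonNeg f)) := gmin (chi R [set e]).
rewrite /Bsupp /= !oppr_eq0 /chi inE (negbTE fe) eqxx => gf.
apply/eqP/negPn/negP => gf0; suff: false by []; apply: gf gf0.
  by exists e; rewrite inE eqxx oner_eq0.
move=> [T|v|h] /=; rewrite /Bsupp /=.
- by move=> /andP[/andP[oT T3] /chi0 eT]; rewrite oT T3 gT.
- by move=> /chi0 ve; rewrite gv.
- rewrite !oppr_eq0 inE; have [->|_] := eqVneq h e; by rewrite ?eqxx.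
Qed.

(** Row sums of a nonnegative vector cannot cancel, so any edge of its support meets the domination
    criterion. *)
Lemma circuit_ge0 g : is_circuit g -> (forall e, 0 <= g e) ->
  exists2 e, 0 < g e & forall f, f != e -> g f = 0.
Proof.
move=> cg g0; have [[e ge] _] := cg.
have gep : 0 < g e by rewrite lt0r ge g0.
have pos (F : pred (edge n)) : F e -> xsum g F != 0.
  move=> Fe; rewrite gt_eqF // /xsum (bigD1 e) //= ltr_pwDl //; exact: sumr_ge0.
by exists e => //; apply: circuit_dominating_edge => // *; apply: pos.
Qed.

(** Coordinates must stay nonnegative on leaving the origin, so the direction is a nonnegative
    circuit. *)
Lemma step_from0 z : circuit_step (chi R set0) z ->
  exists2 e, 0 < z e <= 1 & forall f, f != e -> z f = 0.
Proof.
move=> [g [a [cg [a0 [aP [_ zE]]]]]].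
have {}zE f : z f = a * g f by rewrite zE /chi inE add0r.
have {}aP : in_Pmatch z.
  by move: aP; congr in_Pmatch; apply: funext => f; rewrite zE /chi inE add0r.
have [f|e ge g0] := circuit_ge0 cg.
  by have := in_Pmatch_ge0 f aP; rewrite zE pmulr_rge0.
exists e => [|f fe]; last by rewrite zE g0 ?mulr0.
by rewrite in_Pmatch_le1 // andbT zE mulr_gt0.
Qed.

(* In six vertices an odd set containing two disjoint edges misses at most one
   vertex, so it contains a second edge of the perfect matching. *)
Lemma perfect6_not_circuit e a b c z : n = 6%N ->
  [disjoint val a & val b] -> [disjoint val a & val c] -> [disjoint val b & val c] ->
  [disjoint val a & val e] -> 0 < z e <= 1 -> (forall f, f != e -> z f = 0) ->
  ~ is_circuit (fun f => chi R [set a; b; c] f - z f).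
Proof.
move=> n6 ab ac bc ae /andP[ze0 ze1] z0; set N := [set a; b; c] => cir.
set h := fun f => _ in cir.
have aN : a \in N by rewrite !inE eqxx.
have bN : b \in N by rewrite !inE eqxx !orbT.
have cN : c \in N by rewrite !inE eqxx !orbT.
have chiN k : k \in N -> chi R N k = 1 by rewrite /chi => ->.
have h1 k : k \in N -> k != e -> h k = 1 by move=> kN ke; rewrite /h chiN // z0 ?subr0.
(* The domination criterion for [a] would make [h] vanish off [a], against [h k = 1]. *)
have out k : k \in N -> k != a -> k != e -> False.
  move=> kN ka ke.
  suff hk : h k = 0 by have /eqP := h1 k kN ke; rewrite hk eq_sym oner_eq0.
  apply: (circuit_dominating_edge cir) ka.
  - by rewrite h1 ?oner_eq0 // edges_disjoint_neq.
  - move=> v va; rewrite /xsum (bigD1 a) //= h1 ?edges_disjoint_neq // big1.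
      by rewrite addr0 oner_eq0.
    move=> f /andP[vf fa]; rewrite /h z0; last first.
      by apply: contraFneq (disjointFr ae va) => <-.
    rewrite subr0 /chi !inE (negbTE fa) /=; case: ifP => // /orP[]/eqP fE; subst f.
      by rewrite /delta (disjointFr ab va) in vf.
    by rewrite /delta (disjointFr ac va) in vf.
  move=> T oT aT; rewrite gt_eqF //.
  have zT : xsum z (inside T) <= (if val e \subset T then 1 else 0).
    case: ifP => eT.
      by rewrite /xsum (bigD1 e) //= big1 ?addr0 // => f /andP[_ fe]; apply: z0.
    rewrite /xsum big1 // => f fT; apply: z0; apply: contraFneq eT => <-; exact: fT.
  have -> : xsum h (inside T) = xsum (chi R N) (inside T) - xsum z (inside T).
    by rewrite /xsum sumrB.
  rewrite subr_gt0.
  case: ifP zT => eT zT; last first.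
    apply: le_lt_trans zT (lt_le_trans ltr01 _).
    rewrite /xsum (bigD1 a) //= chiN // lerDl; apply: sumr_ge0 => f _; exact: chi_ge0.
  (* [T] contains the disjoint edges [a] and [e], hence four vertices, and parity adds a fifth. *)
  have T5 : (5 <= #|T|)%N.
    have : (4 <= #|T|)%N.
      rewrite -(edge_cardU2 ae); apply: subset_leq_card; rewrite subUset aT; exact: eT.
    by rewrite leq_eqVlt => /orP[/eqP T4|//]; rewrite -T4 in oT.
  (* Otherwise [b] and [c] would each have a vertex outside [T], two distinct ones, making seven
     vertices in all. *)
  have [k' [k'N k'a k'T]] : exists k', [/\ k' \in N, k' != a & val k' \subset T].
    have [bT|/subsetPn[u ub uT]] := boolP (val b \subset T).
      by exists b; split => //; rewrite eq_sym edges_disjoint_neq.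
    have [cT|/subsetPn[v vc vT]] := boolP (val c \subset T).
      by exists c; split => //; rewrite eq_sym edges_disjoint_neq.
    have uv : u != v by apply: contraFneq (disjointFr bc ub) => ->.
    have C2 : (2 <= #|~: T|)%N.
      have <- : #|[set u; v]| = 2%N by rewrite cards2 uv.
      by apply: subset_leq_card; rewrite subUset !sub1set !inE uT vT.
    have n7 : (7 <= n)%N.
      by rewrite -[X in (_ <= X)%N]card_ord -(cardsC T); apply: leq_add T5 C2.
    by have := leq_trans n7 (eq_leq n6).
  apply: le_lt_trans zT (@lt_le_trans _ _ 2 _ _ _ _); first by rewrite ltr1n.
  rewrite /xsum (bigD1 a) //= (bigD1 k') /=; last by rewrite /inside k'T.
  rewrite !chiN // addrA lerDl; apply: sumr_ge0 => f _; exact: chi_ge0.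
(* At most one of [b] and [c] equals [e]; the other contradicts [out]. *)
have [be|be] := eqVneq b e; last by apply: (out b) => //; rewrite eq_sym edges_disjoint_neq.
apply: (out c) => //; first by rewrite eq_sym edges_disjoint_neq.
by rewrite -be eq_sym edges_disjoint_neq.
Qed.

(** * Matchings that witness the lower bounds *)

Lemma matching2 a b : [disjoint val a & val b] -> is_matching [set a; b].
Proof.
move=> ab; apply: matchingP => e f v; rewrite !inE.
move=> /orP[]/eqP-> /orP[]/eqP-> // ve vf.
  by rewrite (disjointFr ab ve) in vf.
by rewrite (disjointFl ab ve) in vf.
Qed.

Lemma matching3 a b c :
  [disjoint val a & val b] -> [disjoint val a & val c] -> [disjoint val b & val c] ->
  is_matching [set a; b; c].
Proof.
move=> ab ac bc; apply: matchingP => e f v; rewrite !inE -!orbA.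
move=> /or3P[]/eqP-> /or3P[]/eqP-> // ve vf.
- by rewrite (disjointFr ab ve) in vf.
- by rewrite (disjointFr ac ve) in vf.
- by rewrite (disjointFl ab ve) in vf.
- by rewrite (disjointFr bc ve) in vf.
- by rewrite (disjointFl ac ve) in vf.
- by rewrite (disjointFl bc ve) in vf.
Qed.

Lemma no_walk_lt2 N a b l : a \in N -> b \in N -> a != b ->
  (l < 2)%N -> ~ circuit_walk l (chi R set0) (chi R N).
Proof.
move=> aN bN ab; case: l => [|[|//]] _.
  by move=> /(_ a)/eqP; rewrite /chi inE aN eq_sym oner_eq0.
move=> [z [/funext <- /step_from0[e _ out]]].
have eqe k : k \in N -> k = e.
  move=> kN; apply/eqP/negPn/negP => /out/eqP.
  by rewrite /chi kN oner_eq0.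
by rewrite (eqe a aN) (eqe b bN) eqxx in ab.
Qed.

(** Pigeonhole: each of the two ends of [e] lies on at most one of the three edges. *)
Lemma edge_disjoint_of_three a b c e :
  [disjoint val a & val b] -> [disjoint val a & val c] -> [disjoint val b & val c] ->
  [|| [disjoint val a & val e], [disjoint val b & val e] | [disjoint val c & val e]].
Proof.
move=> ab ac bc; have /cards2P[p [q [_ eE]]] := valP e.
have meet k : ~~ [disjoint val k & val e] -> (p \in val k) || (q \in val k).
  rewrite -setI_eq0 => /set0Pn[v]; rewrite inE eE !inE => /andP[vk].
  by move=> /orP[]/eqP <-; rewrite vk ?orbT.
have once v k k' : [disjoint val k & val k'] -> v \in val k -> v \in val k' -> false.
  by move=> dis vk; rewrite (disjointFr dis vk).
apply: contraT; rewrite !negb_or => /and3P[/meet ma /meet mb /meet mc].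
have pab := once p _ _ ab; have pac := once p _ _ ac; have pbc := once p _ _ bc.
have qab := once q _ _ ab; have qac := once q _ _ ac; have qbc := once q _ _ bc.
by case/orP: ma => ka; case/orP: mb => kb; case/orP: mc => kc; auto.
Qed.

(** A second step to the target would have a multiple of the remaining difference as its circuit.
    The edge [e] reached first misses one of [a], [b], [c], and that edge takes the role of [a] in
    [perfect6_not_circuit]. *)
Lemma perfect6_no_walk a b c l : n = 6%N ->
  [disjoint val a & val b] -> [disjoint val a & val c] -> [disjoint val b & val c] ->
  (l < 3)%N -> ~ circuit_walk l (chi R set0) (chi R [set a; b; c]).
Proof.
move=> n6 ab ac bc; rewrite ltnS leq_eqVlt => /orP[/eqP ->|l2]; last first.
  apply: (no_walk_lt2 (a := a) (b := b)) => //; last exact: edges_disjoint_neq.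
    by rewrite !inE eqxx.
  by rewrite !inE eqxx orbT.
move=> [z [[z0 [/funext <- /step_from0[e ze zout]]]]].
move=> [g [t [cg [t0 [_ [_ NE]]]]]].
have cir : is_circuit (fun f => chi R [set a; b; c] f - z f).
  apply: (@circuit_scale t _ g) => // [|f]; first by rewrite gt_eqF.
  by rewrite NE [LHS]addrC addKr.
have [ae|be|ce] := or3P (edge_disjoint_of_three e ab ac bc).
- exact: (perfect6_not_circuit n6 ab ac bc ae ze zout cir).
- apply: (perfect6_not_circuit (a := b) (b := a) (c := c) n6 _ _ _ be ze zout) => //.
    by rewrite disjoint_sym.
  by rewrite [[set b; a]]setUC.
- apply: (perfect6_not_circuit (a := c) (b := a) (c := b) n6 _ _ _ ce ze zout) => //.
  + by rewrite disjoint_sym.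
  + by rewrite disjoint_sym.
  by rewrite -setUA setUC.
Qed.

(** The edge joins 2i and 2i + 1; describing it through [v./2] reduces disjointness to a comparison
    of indices. *)
Lemma block_edge i : (i.*2.+1 < n)%N -> exists e, forall v, (v \in val e) = (v./2 == i :> nat).
Proof.
move=> in'; have in0 : (i.*2 < n)%N by apply: ltnW.
have ab : Ordinal in0 != Ordinal in' by rewrite -val_eqE /= ltn_eqF.
by exists (mk_edge ab) => v; rewrite !inE -!val_eqE /=; lia.
Qed.

End Polytope.

(** * Assembly over the ranges of [n] *)

Theorem theorem1 (R : realType) (n : nat) (hn : (2 <= n)%N) :
  circuit_diameter_is R n
    (if (n <= 3)%N then 1%N
     else if (n <= 5)%N then 2%N
     else if n == 6%N then 3%N
     else 2%N).
Proof.
have upper k :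
    (forall M N : {set edge n}, is_matching M -> is_matching N ->
       exists l, (l <= k)%N /\ circuit_walk l (chi R M) (chi R N)) ->
    forall u v : vec R n, is_vertex u -> is_vertex v ->
      exists l, (l <= k)%N /\ circuit_walk l u v.
  by move=> H u v /vertexE[M mM ->] /vertexE[N mN ->]; apply: H.
have m0 : is_matching (set0 : {set edge n}).
  by apply: matchingP => e f v; rewrite inE.
have disj i j (a b : edge n) : i != j ->
    (forall v, (v \in val a) = (v./2 == i)) -> (forall v, (v \in val b) = (v./2 == j)) ->
    [disjoint val a & val b].
  move=> ij aE bE; rewrite -setI_eq0; apply/set0Pn => -[v].
  by rewrite inE aE bE => /andP[/eqP -> ]; apply/negP.
have lower2 : (4 <= n)%N -> exists u v : vec R n, is_vertex u /\ is_vertex v /\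
    forall l, (l < 2)%N -> ~ circuit_walk l u v.
  move=> n4; have [a aE] := @block_edge n 0 (leq_trans (isT : 2 <= 4)%N n4).
  have [b bE] := @block_edge n 1 n4.
  have ab := disj 0 1 a b isT aE bE.
  exists (chi R set0), (chi R [set a; b]); split; first exact: vertex_chi.
  split; first by apply: vertex_chi; apply: matching2.
  move=> l; apply: (no_walk_lt2 (a := a) (b := b)); rewrite ?inE ?eqxx ?orbT //.
  exact: edges_disjoint_neq.
have [n3|n3] := leqP n 3.
  split.
    apply: upper => M N mM mN; have [->|MN] := eqVneq M N; first by exists 0%N.
    by exists 1%N; split => //; apply/walk1/step_le3.
  have [a _] := @block_edge n 0 hn.
  exists (chi R set0), (chi R [set a]); split; first exact: vertex_chi.
  split.
    by apply: vertex_chi; apply: matchingP => e f v; rewrite !inE => /eqP -> /eqP ->.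
  (* Only length 0 has to be excluded, and the two vertices differ at [a]. *)
  by case=> // _ /(_ a)/eqP; rewrite /chi !inE eqxx eq_sym oner_eq0.
have [n5|n5] := leqP n 5.
  by split; [apply: upper => M N; apply: walk_le5 | apply: lower2].
have [n6|n6] := eqVneq n 6%N; last first.
  have n7 : (7 <= n)%N by rewrite ltn_neqAle eq_sym n6.
  by split; [apply: upper => M N; apply: walk_ge7 | apply: lower2].
split; first by apply: upper => M N; apply: walk_le7; rewrite n6.
(* The blocks 0, 1 and 2 form a perfect matching of the six vertices. *)
have [a aE] := @block_edge n 0 hn; have [b bE] := @block_edge n 1 n3.
have [c cE] := @block_edge n 2 n5.
have ab := disj 0 1 a b isT aE bE; have ac := disj 0 2 a c isT aE cE.
have bc := disj 1 2 b c isT bE cE.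
exists (chi R set0), (chi R [set a; b; c]); split; first exact: vertex_chi.
split; first by apply: vertex_chi; apply: matching3.
by move=> l; apply: perfect6_no_walk.
Qed.
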